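(* Let $t_0<T$ be fixed, let $x_0\in\mathbb{R}^n$, let $I$ be a finite nonempty index set, and let $\Phi^k$, $k\in I$, be continuously differentiable real-valued functions of $(x,t)\in\mathbb{R}^n\times\mathbb{R}$. Consider the optimal control problem described in the context whose only terminal constraints are the inequalities $\Phi^k(x(T),T)\le0$, $k\in I$, let $(x^*,u^* )$ be an optimal pair with $\Phi^k(x^*(T),T)=0$ for all $k\in I$, and put $z^*=\dot x^*$. Suppose that the Mangasarian–Fromovitz condition holds: there exists $d\in\mathbb{R}^n$ with $\langle\nabla\Phi^k(x^*(T),T),d\rangle<0$ for all $k\in I$. Then there exist a neighborhood $B$ of $z^*$ and a constant $a>0$ such that $$\operatorname{dist}\bigl(0,\partial\phi_{\mathrm{term}}(z)\bigr)\ge a\quad\text{for all } z\in B,$$ in particular for all $z\in B$ with $\phi_{\mathrm{term}}(z)>0$.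
   Context: Setting: minimize $\Phi^0(x(T),T)$, with $\Phi^0$ continuously differentiable, over piecewise continuous controls $u$ with values in a compact set $V\subset\mathbb{R}^m$ and piecewise continuously differentiable states $x:[t_0,T]\to\mathbb{R}^n$ subject to $\dot x(t)=f(x(t),u(t),t)$, $x(t_0)=x_0$, and the terminal constraints. The map $f$ is differentiable in $x$, Lipschitz in $x$ uniformly in $(u,t)$, and $f$ and $\partial f/\partial x$ are continuous. The state is parametrized by its derivative $z=\dot x$ (piecewise continuous, $\mathbb{R}^n$-valued on $[t_0,T]$), $x_T=x_0+\int_{t_0}^T z(t)\,dt$; neighborhoods of $z^*$ are in the $L_2$ topology. The terminal penalty is $\phi_{\mathrm{term}}(z)=\max_{k\in I}\Phi^k(x_T,T)$, and its subdifferential is $$\partial\phi_{\mathrm{term}}(z)=\operatorname{co}\{\nabla\Phi^k(x_T,T): k\in I,\ \Phi^k(x_T,T)=\phi_{\mathrm{term}}(z)\}\subset\mathbb{R}^n,$$ with gradients in the spatial variable $x$ and $\operatorname{co}$ the convex hull. (A vector of $\mathbb{R}^n$ is identified with the corresponding constant function in $L_2$; distance is Euclidean distance in $\mathbb{R}^n$.) *)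

(* Defs.v *)
From HB Require Import structures.
From mathcomp Require Import all_boot all_order all_algebra.
From mathcomp Require Import all_classical all_reals all_analysis.
Set Implicit Arguments.
Unset Strict Implicit.
Unset Printing Implicit Defensive.
Import Order.TTheory GRing.Theory Num.Theory.
Import numFieldNormedType.Exports.
Local Open Scope classical_set_scope.
Local Open Scope ring_scope.

(* The library norm on 'rV[R]_n is the sup norm; it has the same topology and
   the same Lipschitz functions (up to the constant) as the Euclidean norm, but
   distances and L2 norms below have to be Euclidean. *)
Definition dotv (R : realType) (n : nat) (v w : 'rV[R]_n) : R :=
  \sum_(i < n) v 0 i * w 0 i.

Definition enorm (R : realType) (n : nat) (v : 'rV[R]_n) : R :=
  Num.sqrt (dotv v v).

(* Meaningful for nonempty A only ([inf set0 = 0]). *)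
Definition euclid_dist (R : realType) (n : nat) (v : 'rV[R]_n)
    (A : set 'rV[R]_n) : R :=
  inf [set enorm (v - w) | w in A].

Definition convex_hull (R : realType) (n : nat) (A : set 'rV[R]_n) :
    set 'rV[R]_n :=
  [set y | exists (N : nat) (c : 'I_N -> R) (p : 'I_N -> 'rV[R]_n),
     [/\ forall i, 0 <= c i, \sum_(i < N) c i = 1, forall i, A (p i)
       & y = \sum_(i < N) c i *: p i]].

(* Gradient of [g (x, t)] in the spatial variable [x]. *)
Definition grad (R : realType) (n : nat) (g : 'rV[R]_n * R -> R)
    (x : 'rV[R]_n) (t : R) : 'rV[R]_n :=
  \row_(i < n) 'D_(delta_mx 0 i) (fun y => g (y, t)) x.

(* In finite dimension, continuity of the differential amounts to continuity
   of its value at every fixed direction. *)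
Definition C1_fun (R : realType) (n : nat) (g : 'rV[R]_n * R -> R) : Prop :=
  (forall p, differentiable g p) /\
  (forall v, continuous (fun p => 'd g p v)).

(* Finitely many discontinuities, with one-sided limits at every point.
   The values of [g] at its discontinuities, and outside [a, b], are free. *)
Definition pw_continuous (R : realType) (n : nat) (a b : R)
    (g : R -> 'rV[R]_n) : Prop :=
  [/\ exists s : seq R, forall t, a < t < b -> t \notin s ->
        {for t, continuous g},
      forall t, a <= t < b -> cvg (g x @[x --> t^'+])
    & forall t, a < t <= b -> cvg (g x @[x --> t^'-])].

(* [z] is the (piecewise continuous) derivative of the continuous function [x]
   on [a, b], except possibly at finitely many points. *)
Definition pw_derivative (R : realType) (n : nat) (a b : R)
    (x z : R -> 'rV[R]_n) : Prop :=
  [/\ {within `[a, b], continuous x},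
      pw_continuous a b z
    & exists s : seq R, forall t, a < t < b -> t \notin s ->
        is_derive t (1 : R) x (z t)].

Definition pw_C1 (R : realType) (n : nat) (a b : R) (x : R -> 'rV[R]_n) :
    Prop :=
  exists z, pw_derivative a b x z.

Definition dyn_domain (R : realType) (n m : nat) (t0 T : R)
    (V : set 'rV[R]_m) : set ('rV[R]_n * 'rV[R]_m * R) :=
  [set p | V p.1.2 /\ t0 <= p.2 <= T].

(* The arguments of [f] are (x, u, t), with x arbitrary, u in V and
   t in [t0, T]. *)
Definition regular_dynamics (R : realType) (n m : nat) (t0 T : R)
    (V : set 'rV[R]_m) (f : 'rV[R]_n * 'rV[R]_m * R -> 'rV[R]_n) : Prop :=
  [/\ forall x u t, V u -> t0 <= t <= T ->
        differentiable (fun y => f (y, u, t)) x,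
      exists L : R, forall u t, V u -> t0 <= t <= T ->
        L.-lipschitz (fun x => f (x, u, t)),
      {within dyn_domain t0 T V, continuous f}
    & {within dyn_domain t0 T V,
        continuous (fun p => 'J (fun y => f (y, p.1.2, p.2)) p.1.1)}].

(* The differential equation holds except at the finitely many times at which
   the piecewise continuously differentiable state may have a corner. *)
Definition feasible (R : realType) (n m : nat) (I : finType) (t0 T : R)
    (x0 : 'rV[R]_n) (V : set 'rV[R]_m)
    (f : 'rV[R]_n * 'rV[R]_m * R -> 'rV[R]_n)
    (Phi : I -> 'rV[R]_n * R -> R)
    (x : R -> 'rV[R]_n) (u : R -> 'rV[R]_m) : Prop :=
  [/\ pw_continuous t0 T u /\ (forall t, t0 <= t <= T -> V (u t)),
      pw_C1 t0 T x,
      exists s : seq R, forall t, t0 < t < T -> t \notin s ->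
        is_derive t (1 : R) x (f (x t, u t, t)),
      x t0 = x0
    & forall k, Phi k (x T, T) <= 0].

Definition optimal_pair (R : realType) (n m : nat) (I : finType) (t0 T : R)
    (x0 : 'rV[R]_n) (V : set 'rV[R]_m)
    (f : 'rV[R]_n * 'rV[R]_m * R -> 'rV[R]_n)
    (Phi0 : 'rV[R]_n * R -> R) (Phi : I -> 'rV[R]_n * R -> R)
    (xs : R -> 'rV[R]_n) (us : R -> 'rV[R]_m) : Prop :=
  feasible t0 T x0 V f Phi xs us /\
  forall x u, feasible t0 T x0 V f Phi x u -> Phi0 (xs T, T) <= Phi0 (x T, T).

Definition endpoint (R : realType) (n : nat) (t0 T : R) (x0 : 'rV[R]_n)
    (z : R -> 'rV[R]_n) : 'rV[R]_n :=
  x0 + \row_(i < n) (\int[lebesgue_measure]_(t in `[t0, T]) (z t 0 i))%R.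

(* [k0] only witnesses that the index set is nonempty: the value does not
   depend on it. *)
Definition phi_term (R : realType) (n : nat) (I : finType) (k0 : I) (t0 T : R)
    (x0 : 'rV[R]_n) (Phi : I -> 'rV[R]_n * R -> R) (z : R -> 'rV[R]_n) : R :=
  \big[Num.max/Phi k0 (endpoint t0 T x0 z, T)]_(k : I)
     Phi k (endpoint t0 T x0 z, T).

Definition subdiff_phi_term (R : realType) (n : nat) (I : finType) (k0 : I)
    (t0 T : R) (x0 : 'rV[R]_n) (Phi : I -> 'rV[R]_n * R -> R)
    (z : R -> 'rV[R]_n) : set 'rV[R]_n :=
  convex_hull [set grad (Phi k) (endpoint t0 T x0 z) T | k in
    [set k | Phi k (endpoint t0 T x0 z, T) = phi_term k0 t0 T x0 Phi z]].

Definition L2_dist (R : realType) (n : nat) (a b : R)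
    (z w : R -> 'rV[R]_n) : R :=
  Num.sqrt (\int[lebesgue_measure]_(t in `[a, b]) (enorm (z t - w t) ^+ 2))%R.

(* Neighborhoods in the space of piecewise continuous functions on [a, b] with
   the L2 topology. *)
Definition L2_nbhs (R : realType) (n : nat) (a b : R) (z : R -> 'rV[R]_n)
    (B : set (R -> 'rV[R]_n)) : Prop :=
  B `<=` pw_continuous a b /\
  exists2 r : R, 0 < r &
    forall w, pw_continuous a b w -> L2_dist a b w z < r -> B w.

(* Main.v *)
Require Import Defs.
From HB Require Import structures.
From mathcomp Require Import all_boot all_order all_algebra.
From mathcomp Require Import all_classical all_reals all_analysis.
From mathcomp Require Import measurable_realfun ring lra.
Import Order.TTheory GRing.Theory Num.Theory.
Import numFieldNormedType.Exports.
Local Open Scope classical_set_scope.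
Local Open Scope ring_scope.

Set Implicit Arguments.
Unset Strict Implicit.
Unset Printing Implicit Defensive.

(** The Mangasarian-Fromovitz direction [d] separates all the gradients at the
    endpoint of [zs] from 0, and by continuity of the gradients it still does,
    with a margin [e], at all nearby endpoints.  Every convex combination [y]
    of such gradients then has [dotv y d <= - e], which bounds its norm from
    below.  It remains to see that nearby derivatives have nearby endpoints:
    the endpoint depends on [z] through an integral, which Cauchy-Schwarz
    controls by the L2 distance, and the fundamental theorem of calculus
    identifies the endpoint of [zs] with [xs T]. *)

(** * Boundedness, measurability and integrability of piecewise continuous functions *)

Lemma pw_continuousB (R : realType) (n : nat) (a b : R) (g h : R -> 'rV[R]_n) :
  pw_continuous a b g -> pw_continuous a b h ->
  pw_continuous a b (fun t => g t - h t).
Proof.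
move=> [[s cg] gr gl] [[s' ch] hr hl]; split.
- exists (s ++ s') => t tab; rewrite mem_cat negb_or => /andP[ts ts'].
  by apply: cvgB; [exact: cg|exact: ch].
- by move=> t tab; apply: is_cvgB; [exact: gr|exact: hr].
- by move=> t tab; apply: is_cvgB; [exact: gl|exact: hl].
Qed.

Lemma cvg_near_bounded (R : realType) (h : R -> R) (F : set_system R) :
  Filter F -> cvg (h x @[x --> F]) ->
  exists M : R, \forall x \near F, `|h x| <= M.
Proof.
move=> FF /cvg_ex[l /= hl]; exists (`|l| + 1).
have /cvgrPdist_le /(_ 1 ltr01) := hl.
apply: filterS => x lx; rewrite -(subrK l (h x)) addrC.
by rewrite (le_trans (ler_normD _ _))// lerD2l distrC.
Qed.

Lemma pw_continuous_bounded (R : realType) (n : nat) (a b : R)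
    (g : R -> 'rV[R]_n) (phi : 'rV[R]_n -> R) :
  pw_continuous a b g -> continuous phi ->
  [bounded phi (g t) | t in `[a, b]].
Proof.
move=> [_ gr gl] cphi; pose h t := phi (g t).
have cvgh (F : set_system R) : ProperFilter F -> cvg (g x @[x --> F]) ->
    cvg (h x @[x --> F]).
  move=> FF /cvg_ex[l gll]; apply/cvg_ex; exists (phi l).
  by apply: (cvg_comp _ _ gll); exact: cphi.
(* Compactness reduces the claim to a local one: around each [t], one bound has to serve all nearby
   points of the segment. The bounds [M1] on the left, [M2] on the right and the value at [t] itself
   together provide it. *)
have /compact_near_coveringP/near_covering_withinP cov := @segment_compact R a b.
apply: (cov _ _ (fun M t => `|h t| <= M)) => t /=.
rewrite in_itv/= => /andP[at_ tb].
have [M1 HM1] : exists M : R, \forall x \near t, x < t -> a <= x -> `|h x| <= M.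
  (* At the left end no left limit is given, but no point of the segment lies to the left either, so
     the bound 0 holds vacuously. The right end is symmetric. *)
  have [ta|ta] := ltP a t; last first.
    exists 0; near=> x => xt ax.
    by move: (le_lt_trans ax xt); rewrite ltNge ta.
  have [|M HM] := @cvg_near_bounded R h (t^'-) _.
    by apply: cvgh; apply: gl; rewrite ta tb.
  by exists M; rewrite near_withinE in HM; apply: filterS HM => x Hx xt _; exact: Hx.
have [M2 HM2] : exists M : R, \forall x \near t, t < x -> x <= b -> `|h x| <= M.
  have [tb'|tb'] := ltP t b; last first.
    exists 0; near=> x => xt ax.
    by move: (lt_le_trans xt ax); rewrite ltNge tb'.
  have [|M HM] := @cvg_near_bounded R h (t^'+) _.
    by apply: cvgh; apply: gr; rewrite at_ tb'.
  by exists M; rewrite near_withinE in HM; apply: filterS HM => x Hx xt _; exact: Hx.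
near=> x M; rewrite /= in_itv/= => /andP[ax xb].
have [xt|xt|->] := ltgtP x t.
- apply: (@le_trans _ _ M1); last by near: M; apply: nbhs_pinfty_ge; exact: num_real.
  exact: (near HM1 x).
- apply: (@le_trans _ _ M2); last by near: M; apply: nbhs_pinfty_ge; exact: num_real.
  exact: (near HM2 x).
- by near: M; apply: nbhs_pinfty_ge; exact: num_real.
Unshelve. all: by end_near. Qed.

(** Away from the endpoints and the exceptional points the composite is continuous on an open set
    [U]; the finitely many remaining points have only countable, hence measurable, subsets. *)
Lemma pw_continuous_measurable (R : realType) (n : nat) (a b : R)
    (g : R -> 'rV[R]_n) (phi : 'rV[R]_n -> R) :
  pw_continuous a b g -> continuous phi ->
  measurable_fun `[a, b] (phi \o g).
Proof.
move=> [[s cg] _ _] cphi.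
have fs (r : seq R) : finite_set [set` r] by apply/finite_seqP; exists r.
pose U := `]a, b[ `\` [set` s].
have oU : open U.
  rewrite /U setDE; apply: openI; first exact: interval_open.
  apply: closed_openC; apply: (accessible_finite_set_closed.1 _ _ (fs s)).
  exact/hausdorff_accessible/Rhausdorff.
have mU : measurable U by exact: open_measurable.
have mS : measurable [set` [:: a, b & s]].
  by apply: countable_measurable => //; exact/finite_set_countable/fs.
apply: (@measurable_funS _ _ _ _ (U `|` [set` [:: a, b & s]])).
- exact: measurableU.
- move=> t /=; rewrite in_itv/= => /andP[at_ tb].
  have [ts|ts] := boolP (t \in [:: a, b & s]); first by right.
  left; move: ts; rewrite !inE !negb_or => /and3P[ta tb' ts].
  by split; [rewrite /= in_itv/= !lt_neqAle tb' eq_sym ta at_ tb|exact/negP].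
- apply/measurable_funU => //; split.
    apply: open_continuous_measurable_fun => // t; rewrite inE => -[/=].
    rewrite in_itv/= => tab /negP ts.
    by apply: continuous_comp; [exact: cg|exact: cphi].
  move=> _ Y mY; apply: countable_measurable => //.
  by apply/finite_set_countable/(sub_finite_set _ (fs [:: a, b & s])) => ? [].
Qed.

Lemma itv_finite_measure (R : realType) (a b : R) :
  (@lebesgue_measure R `[a, b] < +oo)%E.
Proof.
by rewrite lebesgue_measure_itv/=; case: ifP => _; rewrite -?EFinB ltry.
Qed.

Lemma pw_continuous_integrable (R : realType) (n : nat) (a b : R)
    (g : R -> 'rV[R]_n) (phi : 'rV[R]_n -> R) :
  pw_continuous a b g -> continuous phi ->
  (@lebesgue_measure R).-integrable `[a, b] (EFin \o (phi \o g)).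
Proof.
move=> pg cphi; apply: measurable_bounded_integrable => //.
- exact: itv_finite_measure.
- exact: pw_continuous_measurable.
- exact: pw_continuous_bounded.
Qed.

(** * Fundamental theorem of calculus and Cauchy-Schwarz for integrals *)

Lemma FTC2_except_finite (R : realType) (s : seq R) (a b : R) (x h : R -> R) :
  a <= b ->
  {within `[a, b], continuous x} ->
  (@lebesgue_measure R).-integrable `[a, b] (EFin \o h) ->
  (forall t, a < t < b -> t \notin s ->
     {for t, continuous h} /\ is_derive t (1 : R) x (h t)) ->
  (\int[lebesgue_measure]_(t in `[a, b]) h t)%R = x b - x a.
Proof.
(* split the interval at the exceptional points one at a time; without them,
   x minus the primitive of h has zero derivative *)
elim: s a b => [|c s IH] a b ab cx ih hx.
  move: ab; rewrite le_eqVlt => /predU1P[<-|ab].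
    by rewrite set_itv1 Rintegral_set1 subrr.
  pose G y := (\int[lebesgue_measure]_(t in `[a, y]) h t)%R.
  have cG : {within `[a, b], continuous G}.
    exact: parameterized_integral_continuous (ltW ab) ih.
  have [t|t|c _] := @MVT R (G \- x) (cst 0) _ _ ab.
  - rewrite in_itv/= => /andP[at_ tb].
    have [||ct dx] := hx t; [by rewrite at_ tb | by rewrite in_nil |].
    have [dG G'] := continuous_FTC1_closed tb ih at_ ct.
    have dGt : is_derive t (1 : R) G (h t).
      by apply: (DeriveDef dG); rewrite -derive1E; exact: G'.
    have := is_deriveB dGt dx; rewrite subrr; exact.
  - by apply: continuousB; [exact: cG|exact: cx].
  - rewrite /= mul0r => /eqP; rewrite subr_eq0 => /eqP.
    have -> : G a = 0 by rewrite /G set_itv1 Rintegral_set1.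
    by move=> E; rewrite -/(G b); lra.
(* An exceptional point outside []a, b[] differs from every interior [t], so it is dropped without
   splitting. *)
have [cab|cab] := boolP (a < c < b); last first.
  apply: IH => // t tab ts; apply: hx => //; rewrite inE negb_or ts andbT.
  by apply: contraNneq cab => <-.
have /andP[ac cb] := cab.
have sl : `[a, c] `<=` `[a, b] by apply: subset_itvl; rewrite bnd_simp ltW.
have sr : `[c, b] `<=` `[a, b] by apply: subset_itvr; rewrite bnd_simp ltW.
have il : (@lebesgue_measure R).-integrable `[a, c] (EFin \o h).
  exact: integrableS ih.
have ir : (@lebesgue_measure R).-integrable `[c, b] (EFin \o h).
  exact: integrableS ih.
have -> : (\int[lebesgue_measure]_(t in `[a, b]) h t)%R =
    (\int[lebesgue_measure]_(t in `[a, c]) h t)%R +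
    (\int[lebesgue_measure]_(t in `[c, b]) h t)%R.
  rewrite -[X in _ = _ + X]Rintegral_itv_obnd_cbnd; last first.
    by apply: integrableS ir => //; exact: subset_itv_oc_cc.
  rewrite -(@Rintegral_itvB _ _ _ _ c ih) ?bnd_simp ?(ltW ac) ?(ltW cb)//.
  by rewrite addrC subrK.
rewrite (IH a c) ?(IH c b) ?ltW//.
- by ring.
- exact: continuous_subspaceW sr cx.
- move=> t /andP[ct tb] ts; apply: hx; first by rewrite tb (lt_trans ac ct).
  by rewrite inE negb_or ts gt_eqF.
- exact: continuous_subspaceW sl cx.
- move=> t /andP[at_ tc] ts; apply: hx; first by rewrite at_ (lt_trans tc cb).
  by rewrite inE negb_or ts lt_eqF.
Qed.

Lemma sqr_Rintegral_le (R : realType) (a b : R) (h : R -> R) : a < b ->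
  (@lebesgue_measure R).-integrable `[a, b] (EFin \o h) ->
  (@lebesgue_measure R).-integrable `[a, b] (EFin \o (fun t => h t ^+ 2)) ->
  (\int[lebesgue_measure]_(t in `[a, b]) h t)%R ^+ 2 <=
  (b - a) * (\int[lebesgue_measure]_(t in `[a, b]) (h t ^+ 2))%R.
Proof.
move=> ab ih ih2; set S := (X in X ^+ 2 <= _); set Q := (X in _ <= _ * X).
have L0 : 0 < b - a by rewrite subr_gt0.
pose c := S / (b - a).
have icst : (@lebesgue_measure R).-integrable `[a, b] (EFin \o cst (c ^+ 2)).
  apply: measurable_bounded_integrable => //; first exact: itv_finite_measure.
  exact: bounded_cst.
have ich : (@lebesgue_measure R).-integrable `[a, b]
    (EFin \o (fun t => (2 * c) * h t)).
  exact: (integrableZl _ (2 * c) ih).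
(* c is the mean of h: expand the integral of (h - c)^2 *)
have : 0 <= (\int[lebesgue_measure]_(t in `[a, b])
    (h t ^+ 2 - 2 * c * h t + c ^+ 2))%R.
  apply: Rintegral_ge0 => t _.
  have -> : h t ^+ 2 - 2 * c * h t + c ^+ 2 = (h t - c) ^+ 2 by ring.
  exact: sqr_ge0.
rewrite RintegralD//; last exact: (integrableB _ ih2 ich).
rewrite RintegralB// RintegralZl// -/S -/Q Rintegral_cst//.
have E : fine (@lebesgue_measure R `[a, b]) = b - a.
  by rewrite lebesgue_measure_itv/= lte_fin ab.
rewrite [fine _]E.
(* With this value of [S] the expanded inequality reads [0 <= Q - c ^+ 2 * (b - a)]; multiplying by
   [b - a] gives the claim. *)
have -> : S = c * (b - a) by rewrite /c divfK// gt_eqF.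
move: L0; nra.
Qed.

(** * Euclidean inner product, convex hulls and distance to the origin *)

Lemma dotv_ge0 (R : realType) (n : nat) (v : 'rV[R]_n) : 0 <= dotv v v.
Proof. by apply: sumr_ge0 => i _; rewrite -expr2 sqr_ge0. Qed.

Lemma enorm_sqr (R : realType) (n : nat) (v : 'rV[R]_n) :
  enorm v ^+ 2 = dotv v v.
Proof. by rewrite sqr_sqrtr// dotv_ge0. Qed.

Lemma coord_sqr_le_dotv (R : realType) (n : nat) (v : 'rV[R]_n) (i : 'I_n) :
  v 0 i ^+ 2 <= dotv v v.
Proof.
rewrite /dotv (bigD1 i)//= -expr2 lerDl.
by apply: sumr_ge0 => j _; rewrite -expr2 sqr_ge0.
Qed.

Lemma coord_le_enorm (R : realType) (n : nat) (v : 'rV[R]_n) (i : 'I_n) :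
  `|v 0 i| <= enorm v.
Proof. by rewrite -sqrtr_sqr ler_wsqrtr// coord_sqr_le_dotv. Qed.

Lemma enormN (R : realType) (n : nat) (v : 'rV[R]_n) : enorm (- v) = enorm v.
Proof.
by congr Num.sqrt; apply: eq_bigr => i _; rewrite !mxE mulrNN.
Qed.

Lemma dotv_le_enorm (R : realType) (n : nat) (v w : 'rV[R]_n) :
  `|dotv v w| <= enorm v * \sum_(i < n) `|w 0 i|.
Proof.
rewrite /dotv mulr_sumr (le_trans (ler_norm_sum _ _ _))//.
by apply: ler_sum => i _; rewrite normrM ler_wpM2r// coord_le_enorm.
Qed.

Lemma dotv_sumZl (R : realType) (n N : nat) (c : 'I_N -> R)
    (p : 'I_N -> 'rV[R]_n) (d : 'rV[R]_n) :
  dotv (\sum_(i < N) c i *: p i) d = \sum_(i < N) c i * dotv (p i) d.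
Proof.
rewrite /dotv; under [RHS]eq_bigr do rewrite mulr_sumr.
rewrite exchange_big/=; apply: eq_bigr => j _.
by rewrite summxE mulr_suml; apply: eq_bigr => i _; rewrite mxE mulrA.
Qed.

Lemma continuous_dotv (R : realType) (n : nat) (T : topologicalType)
    (v w : T -> 'rV[R]_n) :
  (forall i, continuous (fun t => v t 0 i)) ->
  (forall i, continuous (fun t => w t 0 i)) ->
  continuous (fun t => dotv (v t) (w t)).
Proof.
move=> cv cw t; apply: cvg_big => [|i _]; first exact: add_continuous.
by apply: cvgM; [exact: cv|exact: cw].
Qed.

(** Linearity, with nonnegative weights of sum 1. Applied to the active gradients, it carries the
    Mangasarian-Fromovitz margin over to the whole subdifferential. *)
Lemma convex_hull_dotv_le (R : realType) (n : nat) (A : set 'rV[R]_n)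
    (d y : 'rV[R]_n) (e : R) :
  (forall p, A p -> dotv p d <= e) -> convex_hull A y -> dotv y d <= e.
Proof.
move=> Ad [N [c [p [c0 c1 Ap ->]]]].
rewrite dotv_sumZl -[e]mul1r -c1 mulr_suml.
by apply: ler_sum => i _; rewrite ler_wpM2l//; exact: Ad.
Qed.

Lemma sub_convex_hull (R : realType) (n : nat) (A : set 'rV[R]_n) :
  A `<=` convex_hull A.
Proof.
move=> y Ay; exists 1%N, (fun=> 1), (fun=> y).
by split=> //; rewrite big_ord1 ?scale1r.
Qed.

(** For [y] in [A], [e <= - dotv y d], which is at most [enorm y] times the l1 norm of [d]. The
    added 1 keeps the denominator positive even when [d] is zero, and nonemptiness of [A] lets the
    lower bound pass to the infimum. *)
Lemma euclid_dist0_ge (R : realType) (n : nat) (A : set 'rV[R]_n)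
    (d : 'rV[R]_n) (e : R) :
  A !=set0 -> 0 <= e -> (forall y, A y -> dotv y d <= - e) ->
  e / (1 + \sum_(i < n) `|d 0 i|) <= euclid_dist 0 A.
Proof.
move=> [y0 Ay0] e0 Ad.
have s0 : 0 <= \sum_(i < n) `|d 0 i| by exact: sumr_ge0.
apply: lb_le_inf; first by exists (enorm (0 - y0)), y0.
move=> _ [y Ay <-]; rewrite sub0r enormN ler_pdivrMr ?ltr_wpDr//.
have := Ad _ Ay; have := dotv_le_enorm y d.
have : 0 <= enorm y by exact: sqrtr_ge0.
rewrite ler_norml => h1 /andP[h2 _] h3; nra.
Qed.

(** * Continuity of the spatial gradient *)

Lemma grad_coord (R : realType) (n : nat) (g : 'rV[R]_n * R -> R)
    (x : 'rV[R]_n) (t : R) (i : 'I_n) : C1_fun g ->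
  grad g x t 0 i = 'd g (x, t) (delta_mx 0 i, 0).
Proof.
move=> [dg _]; rewrite mxE -deriveE// /derive.
(* The difference quotients of the slice at [t] are those of [g] along a direction with zero time
   component, so the limits agree. *)
suff E : (fun h : R => h^-1 *: (((fun y => g (y, t)) \o shift x)
      (h *: delta_mx 0 i) - g (x, t))) =
    (fun h : R => h^-1 *: ((g \o shift (x, t)) (h *: (delta_mx 0 i, 0)) - g (x, t))).
  by rewrite E.
apply/funext => h /=; congr (_ *: (g _ - _)).
by congr pair; rewrite /= scaler0 add0r.
Qed.

Lemma continuous_grad_coord (R : realType) (n : nat) (g : 'rV[R]_n * R -> R)
    (t : R) (i : 'I_n) : C1_fun g -> continuous (fun x => grad g x t 0 i).
Proof.
move=> C1g; under eq_fun do rewrite grad_coord//.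
move=> x; apply: (@continuous_comp _ _ _ (fun y => (y, t))
  (fun p => 'd g p (delta_mx 0 i, 0))); last exact: C1g.2.
have : (fun y => (y, t)) @ (nbhs x) --> (nbhs x, nbhs t).
  by apply: cvg_pair; [exact: cvg_id|exact: cvg_cst].
exact.
Qed.

(** Both the default value at [k0] and the larger of two attained values are attained. This makes
    the set of active indices, and with it the subdifferential, nonempty. *)
Lemma phi_term_attained (R : realType) (n : nat) (I : finType) (k0 : I)
    (t0 T : R) (x0 : 'rV[R]_n) (Phi : I -> 'rV[R]_n * R -> R)
    (z : R -> 'rV[R]_n) :
  exists k, Phi k (endpoint t0 T x0 z, T) = phi_term k0 t0 T x0 Phi z.
Proof.
rewrite /phi_term; elim/big_ind: _ => [|_ _ [k <-] [l <-]|k _]; first by exists k0.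
  rewrite /Num.max; case: ifP => _; by [exists l|exists k].
by exists k.
Qed.

(** * The endpoint as a function of the derivative *)

Lemma endpoint_pw_derivative (R : realType) (n : nat) (t0 T : R)
    (x z : R -> 'rV[R]_n) :
  t0 < T -> pw_derivative t0 T x z -> endpoint t0 T (x t0) z = x T.
Proof.
move=> t0T [cx pz [s dx]]; have [[s' cz] _ _] := pz.
apply/rowP => i; rewrite !mxE.
(* The exceptional points are those where [x] may fail to have derivative [z], together with the
   discontinuities of [z]. *)
rewrite (@FTC2_except_finite _ (s ++ s') _ _ (fun t => x t 0 i)) ?ltW//.
- by rewrite addrC subrK.
- by move=> t; exact: continuous_comp (cx t) (@coord_continuous R 1 n 0 i (x t)).
- exact: (pw_continuous_integrable pz (@coord_continuous R 1 n 0 i)).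
- move=> t tT; rewrite mem_cat negb_or => /andP[ts ts']; split.
    apply: (@continuous_comp _ _ _ z (fun v : 'rV[R]_n => v 0 i)).
      exact: cz.
    exact: coord_continuous.
  have [d1 d2] := dx t tT ts; apply: DeriveDef.
    exact: (derivable_mxP _ _ _).1.
  by rewrite -d2 derive_mx// mxE.
Qed.

(** The initial state cancels; Cauchy-Schwarz on coordinate [i] of [z - w] gives the factor
    [T - t0], and the squared coordinate is at most the squared Euclidean norm. *)
Lemma endpoint_L2_dist (R : realType) (n : nat) (t0 T : R) (x0 : 'rV[R]_n)
    (z w : R -> 'rV[R]_n) (i : 'I_n) :
  t0 < T -> pw_continuous t0 T z -> pw_continuous t0 T w ->
  (endpoint t0 T x0 z 0 i - endpoint t0 T x0 w 0 i) ^+ 2 <=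
  (T - t0) * L2_dist t0 T z w ^+ 2.
Proof.
move=> t0T pz pw; have pd := pw_continuousB pz pw.
have cc : continuous (fun v : 'rV[R]_n => v 0 i) by exact: coord_continuous.
rewrite !mxE opprD addrACA subrr add0r -RintegralB//; last 2 first.
- exact: (pw_continuous_integrable pz cc).
- exact: (pw_continuous_integrable pw cc).
have ci : (@lebesgue_measure R).-integrable `[t0, T]
    (EFin \o (fun t => (z t 0 i - w t 0 i) ^+ 2)).
  rewrite (_ : (fun t => _) = (fun v : 'rV[R]_n => v 0 i ^+ 2) \o
    (fun t => z t - w t)); last by apply/funext => t /=; rewrite !mxE.
  by apply: pw_continuous_integrable pd _ => v; exact: (cvgM (cc v) (cc v)).
apply: le_trans (sqr_Rintegral_le _ _ _) _ => //.
  rewrite (_ : (fun t => _) = (fun v : 'rV[R]_n => v 0 i) \o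
    (fun t => z t - w t)); last by apply/funext => t /=; rewrite !mxE.
  exact: pw_continuous_integrable pd cc.
rewrite ler_pM2l ?subr_gt0// sqr_sqrtr; last first.
  by apply: Rintegral_ge0 => t _; exact: sqr_ge0.
apply: le_Rintegral => //.
  apply: (pw_continuous_integrable (phi := fun v => enorm v ^+ 2) pd).
  under eq_fun do rewrite enorm_sqr.
  by apply: continuous_dotv => j; exact: coord_continuous.
move=> t _; rewrite enorm_sqr; have := coord_sqr_le_dotv (z t - w t) i.
by rewrite !mxE.
Qed.

Theorem mainTheorem3 (R : realType) (n m : nat) (I : finType) (k0 : I)
    (t0 T : R) (x0 : 'rV[R]_n) (V : set 'rV[R]_m)
    (f : 'rV[R]_n * 'rV[R]_m * R -> 'rV[R]_n)
    (Phi0 : 'rV[R]_n * R -> R) (Phi : I -> 'rV[R]_n * R -> R)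
    (xs : R -> 'rV[R]_n) (us : R -> 'rV[R]_m) (zs : R -> 'rV[R]_n)
    (ht : t0 < T)
    (hV : compact V)
    (hf : regular_dynamics t0 T V f)
    (hPhi0 : C1_fun Phi0)
    (hPhi : forall k, C1_fun (Phi k))
    (hopt : optimal_pair t0 T x0 V f Phi0 Phi xs us)
    (hactive : forall k, Phi k (xs T, T) = 0)
    (hzs : pw_derivative t0 T xs zs)
    (hMF : exists d : 'rV[R]_n, forall k, dotv (grad (Phi k) (xs T) T) d < 0) :
  exists (B : set (R -> 'rV[R]_n)) (a : R),
    [/\ L2_nbhs t0 T zs B,
        0 < a,
        forall z, B z ->
          a <= euclid_dist 0 (subdiff_phi_term k0 t0 T x0 Phi z)
      & forall z, B z -> 0 < phi_term k0 t0 T x0 Phi z ->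
          a <= euclid_dist 0 (subdiff_phi_term k0 t0 T x0 Phi z)].
Proof.
have [d dMF] := hMF.
have xs0 : xs t0 = x0 by have [[]] := hopt.
have exs : endpoint t0 T x0 zs = xs T.
  by rewrite -xs0; exact: endpoint_pw_derivative.
have pzs : pw_continuous t0 T zs by have [] := hzs.
(* Finiteness of [I] allows one margin for all gradients: each strict inequality survives every
   small enough [e]. *)
have [e e0 He] : exists2 e : R, 0 < e &
    forall k, dotv (grad (Phi k) (xs T) T) d < - e.
  have H : \forall e \near (0 : R)^'+,
      forall k, dotv (grad (Phi k) (xs T) T) d < - e.
    apply: filter_forall => k; near=> e.
    by rewrite ltrNr; near: e; apply: nbhs_right_lt; rewrite oppr_gt0.
  near (0 : R)^'+ => e; exists e => //; exact: (near H e).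
have : \forall x \near xs T, forall k, dotv (grad (Phi k) x T) d < - e.
  apply: (@filter_forall _ _ (fun k x => dotv (grad (Phi k) x T) d < - e) _
    (nbhs_filter (xs T))) => k.
  have cdot : continuous (fun x => dotv (grad (Phi k) x T) d).
    apply: continuous_dotv => i; first exact: continuous_grad_coord.
    exact: cst_continuous.
  exact: cvgr_lt (cdot (xs T)) _ (He k).
move=> /nbhs_ballP[r /= r0 near_xs].
have L0 : 0 < T - t0 by rewrite subr_gt0.
(* By [endpoint_L2_dist], this radius keeps every coordinate of the endpoint within [r] of that of
   [xs T], which is what the sup-norm ball [ball (xs T) r] requires. *)
pose B := [set w | pw_continuous t0 T w /\
  L2_dist t0 T w zs < r / Num.sqrt (T - t0)].
pose a := e / (1 + \sum_(i < n) `|d 0 i|).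
have aB z : B z -> a <= euclid_dist 0 (subdiff_phi_term k0 t0 T x0 Phi z).
  move=> [pz dz].
  have ball_z : ball (xs T) r (endpoint t0 T x0 z).
    split=> // i j; rewrite !ord1 -exs /ball/= distrC.
    rewrite -(@ltr_pXn2r _ 2)// ?nnegrE ?(ltW r0)// real_normK ?num_real//.
    apply: (le_lt_trans (endpoint_L2_dist x0 j ht pz pzs)).
    rewrite -ltr_pdivlMl// -[X in _ < X * _]sqr_sqrtr; last first.
      by rewrite invr_ge0 ltW.
    rewrite sqrtrV ?ltW// -exprMn mulrC.
    by rewrite ltr_pXn2r// nnegrE ?sqrtr_ge0// divr_ge0 ?sqrtr_ge0// ltW.
  apply: euclid_dist0_ge; last 2 first.
  - exact: ltW.
  - move=> y; apply: convex_hull_dotv_le => _ [k _ <-].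
    exact/ltW/near_xs.
  (* The gradient of an active constraint witnesses that the subdifferential is nonempty. *)
  have [k Ek] := phi_term_attained k0 t0 T x0 Phi z.
  exists (grad (Phi k) (endpoint t0 T x0 z) T).
  by apply: sub_convex_hull; exists k.
exists B, a; split=> //.
- split; first by move=> w [].
  by exists (r / Num.sqrt (T - t0)) => //; rewrite divr_gt0// sqrtr_gt0.
- by rewrite divr_gt0// ltr_wpDr// sumr_ge0.
- by move=> z Bz _; exact: aB.
Unshelve. all: by end_near. Qed.
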